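(* Let $n\ge 2$ and $d$ be integers and let $\alpha\in\mathbb{R}$. Define integers $a,t,l,m$ by $$d=na-t,\quad 0\le t<n,\qquad a-t=l(n-1)+m,\quad 0\le m<n-1.$$ Then $G(\alpha;n,d,1)\neq\emptyset$ if and only if $$t<\alpha<\frac{d}{n-1}-\frac{mn}{n-1}.$$
   Context: Work on the projective line $\mathbb{P}^1$ over an algebraically closed field. A coherent system of type $(n,d,k)$ is a pair $(E,V)$ where $E$ is a vector bundle of rank $n$ and degree $d$ on $\mathbb{P}^1$ and $V\subset H^0(E)$ is a vector subspace of dimension $k$. For $\alpha\in\mathbb{R}$ its $\alpha$-slope is $\mu_\alpha(E,V)=\frac{d}{n}+\alpha\frac{k}{n}$. A coherent subsystem of $(E,V)$ is a coherent system $(E',V')$ with $E'$ a (nonzero) subbundle of $E$ and $V'\subset V\cap H^0(E')$; it is proper if $(E',V')\neq(E,V)$. $(E,V)$ is $\alpha$-stable if $\mu_\alpha(E',V')<\mu_\alpha(E,V)$ for every proper coherent subsystem $(E',V')$. $G(\alpha;n,d,k)$ denotes the moduli space of $\alpha$-stable coherent systems of type $(n,d,k)$ on $\mathbb{P}^1$. *)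

(* Defs.v *)
From HB Require Import structures.
From mathcomp Require Import all_boot all_order all_algebra.
From mathcomp Require Import classical_sets reals.

Set Implicit Arguments.
Unset Strict Implicit.
Unset Printing Implicit Defensive.

Import Order.TTheory GRing.Theory Num.Theory.
Local Open Scope classical_set_scope.
Local Open Scope ring_scope.

(* P^1 is glued from two affine lines, with coordinates x (chart 0) and y
   (chart 1), along y = 1/x on the complement of the two origins; its function
   field is K(x).  Vector bundles on an affine line are trivial, so a vector
   bundle of rank n on P^1 is two free bundles of rank n, one per chart, and a
   transition matrix in GL_n(K[x, 1/x]). *)

Definition ratfun (K : closedFieldType) : fieldType := {fraction {poly K}}.

Section ProjectiveLine.
Variable K : closedFieldType.
Local Notation F := (ratfun K).

Definition xcoord : F := FracField.tofrac ('X : {poly K}).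

Definition chart0 (p : {poly K}) : F := FracField.tofrac p.

(* Here the indeterminate of p stands for y: the result is p(1/x). *)
Definition chart1 (p : {poly K}) : F :=
  (map_poly (fun c : K => chart0 c%:P) p).[xcoord^-1].

(* Regular functions on the overlap of the charts: K[x, 1/x]. *)
Definition laurent (f : F) : Prop :=
  exists (p : {poly K}) (N : nat), f = chart0 p / xcoord ^+ N.

Record vector_bundle (n : nat) := VectorBundle {
  transition : 'M[F]_n;
  transition_unit : transition \in unitmx;
  transition_laurent : forall i j, laurent (transition i j);
  transition_inv_laurent : forall i j, laurent (invmx transition i j)
}.

(* The determinant line bundle has transition function \det g = c x^e, and
   with the gluing convention s_0 = g s_1 of [global_sections] the transition
   function x^e defines O(e): its sections are the polynomials s_0(x) of degree
   at most e. *)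
Definition has_degree (n : nat) (E : vector_bundle n) (e : int) : Prop :=
  exists2 c : K, c != 0 & \det (transition E) = chart0 c%:P * xcoord ^ e.

(* Local expressions (s_0(x), s_1(y)) of a section. *)
Definition section_data (n : nat) : lmodType {poly K} :=
  ('cV[{poly K}]_n * 'cV[{poly K}]_n)%type.

Definition global_sections (n : nat) (E : vector_bundle n) :
    set (section_data n) :=
  [set s | map_mx chart0 s.1 = transition E *m map_mx chart1 s.2].

(* K-linear subspaces and their dimension; a scalar c : K acts as the constant
   polynomial c%:P. *)
Definition subspace (n : nat) (V : set (section_data n)) : Prop :=
  V 0 /\ forall (c : K) (s t : section_data n),
    V s -> V t -> V (c%:P *: s + t).

Definition has_dim (n : nat) (V : set (section_data n)) (k : nat) : Prop :=
  exists b : 'I_k -> section_data n,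
    (forall c : 'I_k -> K, \sum_i (c i)%:P *: b i = 0 -> forall i, c i = 0) /\
    V = [set s | exists c : 'I_k -> K, s = \sum_i (c i)%:P *: b i].

(* Local expressions (A_0(x), A_1(y)) of a morphism from rank n' to rank n. *)
Definition hom_data (n' n : nat) : Type :=
  ('M[{poly K}]_(n, n') * 'M[{poly K}]_(n, n'))%type.

Definition is_hom (n' n : nat) (E' : vector_bundle n') (E : vector_bundle n)
    (A : hom_data n' n) : Prop :=
  map_mx chart0 A.1 *m transition E' = transition E *m map_mx chart1 A.2.

Definition is_iso (n' n : nat) (E' : vector_bundle n') (E : vector_bundle n)
    (A : hom_data n' n) : Prop :=
  is_hom E' E A /\
  exists B : hom_data n n', [/\ is_hom E E' B,
    A.1 *m B.1 = 1%:M, B.1 *m A.1 = 1%:M,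
    A.2 *m B.2 = 1%:M & B.2 *m A.2 = 1%:M].

(* A subbundle is a morphism that is injective on the fibre over every point
   of P^1; as K is algebraically closed, K-points suffice. *)
Definition is_subbundle (n' n : nat) (E' : vector_bundle n')
    (E : vector_bundle n) (A : hom_data n' n) : Prop :=
  is_hom E' E A /\
  forall u : K, \rank (map_mx (fun p : {poly K} => p.[u]) A.1) = n' /\
                \rank (map_mx (fun p : {poly K} => p.[u]) A.2) = n'.

Definition hom_sections (n' n : nat) (A : hom_data n' n)
    (s : section_data n') : section_data n :=
  (A.1 *m s.1, A.2 *m s.2).

Record coherent_system (n : nat) (d : int) (k : nat) := CoherentSystem {
  bundle : vector_bundle n;
  sections : set (section_data n);
  bundle_degree : has_degree bundle d;
  sections_global : sections `<=` global_sections bundle;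
  sections_subspace : subspace sections;
  sections_dim : has_dim sections k
}.

Definition is_subsystem (n' n : nat) (d' d : int) (k' k : nat)
    (S' : coherent_system n' d' k') (S : coherent_system n d k)
    (A : hom_data n' n) : Prop :=
  [/\ (0 < n')%N, is_subbundle (bundle S') (bundle S) A
    & hom_sections A @` sections S' `<=` sections S].

(* A is an isomorphism of coherent systems; for a subsystem this says that
   (E', V') is the whole of (E, V). *)
Definition is_system_iso (n' n : nat) (d' d : int) (k' k : nat)
    (S' : coherent_system n' d' k') (S : coherent_system n d k)
    (A : hom_data n' n) : Prop :=
  is_iso (bundle S') (bundle S) A /\
  hom_sections A @` sections S' = sections S.

Definition isomorphic (n : nat) (d : int) (k : nat)
    (S' S : coherent_system n d k) : Prop :=
  exists A : hom_data n n, is_system_iso S' S A.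

Variable R : realType.

Definition slope (alpha : R) (n : nat) (d : int) (k : nat) : R :=
  d%:~R / n%:R + alpha * (k%:R / n%:R).

Definition stable (alpha : R) (n : nat) (d : int) (k : nat)
    (S : coherent_system n d k) : Prop :=
  forall (n' : nat) (d' : int) (k' : nat) (S' : coherent_system n' d' k')
      (A : hom_data n' n),
    is_subsystem S' S A -> ~ is_system_iso S' S A ->
    slope alpha n' d' k' < slope alpha n d k.

(* The closed points of the moduli space G(alpha; n, d, k): isomorphism classes
   of alpha-stable coherent systems. *)
Definition moduli (alpha : R) (n : nat) (d : int) (k : nat) :
    set (set (coherent_system n d k)) :=
  [set C | exists2 S, stable alpha S & C = [set T | isomorphic T S]].

End ProjectiveLine.

(* Main.v *)
Require Import Defs.
From HB Require Import structures.
From mathcomp Require Import all_boot all_order all_algebra.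
From mathcomp Require Import perm classical_sets reals.
From mathcomp Require Import ring lra zify.
Import Order.TTheory GRing.Theory Num.Theory.
Set Implicit Arguments.
Unset Strict Implicit.
Unset Printing Implicit Defensive.
Local Open Scope classical_set_scope.
Local Open Scope ring_scope.

(** Put f = n l + t + m.  The hypotheses give d = (n-1) (n l + t) + n m
    = (n-1) f + m, so a is the ceiling of d/n and f the floor of d/(n-1), and the
    upper bound of the theorem is n l + t = n f - d.

    Necessity.  Let (E,V) be stable with V spanned by s.  By the theorem of
    Birkhoff and Grothendieck ([birkhoff_grothendieck]) E is a sum of line
    bundles, so it contains a line subbundle of degree e >= d/n, that is e >= a
    ([line_subbundle]); with the zero space of sections it must satisfy
    e < (d + alpha)/n, which gives alpha > t.  Next, saturate s to a line
    subbundle of E ([saturate]), of degree at least 0.  The quotient has rank n-1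
    and degree at most d; splitting it again gives a line quotient E -> O(b) that
    kills s with b <= d/(n-1), hence b <= f.  Its kernel is a subbundle of rank
    n-1 and degree d - b that contains s ([corank1_subbundle]), and stability
    becomes alpha < n b - d <= n f - d.

    Sufficiency.  The bundle is the balanced one, O(a-1)^t + O(a)^(n-t).
    If alpha > t, every subbundle without section obeys the inequality, because
    E lies in O(a)^n and so a subbundle of rank n' has degree at most n' a.  What
    remains is a section s such that a subbundle of rank r+1 through s has degree
    at most f r + m.  The section has monomial components x^(c_i), and the
    exponents increase by f - a_i, where a_i is the degree of the i-th summand, so
    that the forms x^(c_(i+1) - c_i) e_i^* - e_(i+1)^* are maps E -> O(f) that
    kill s.  Together they form a map to O(f)^(n-1) whose kernel at the generic
    point is spanned by s.
    A subbundle E' through s is then, up to the saturation of s in E' (a line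
    bundle of degree at most m, since s vanishes to order m at infinity and at
    no other point), a subsheaf of O(f)^(n-1), which bounds its degree
    ([subbundle_section_degree_le]).

    All degree estimates come down to one fact ([monomial_le]): if
    c x^e p(x) = c' x^e' p'(1/x) with polynomials p, p' and p nonzero, then
    e <= e'.  Bundles are handled through frames: pairs of invertible matrices
    over K[x] and K[y] that bring the transition matrix to a simpler form. *)


(** * Polynomial matrices over a field *)

Section PolyMatrices.
Variable K : fieldType.

(** Expand along row i: the cofactors of that row are those of the identity. *)
Lemma det_replace_row (A : comNzRingType) n (i : 'I_n) (a : 'rV[A]_n) :
  \det (\matrix_(k, j) (if k == i then a 0 j else (k == j)%:R)) = a 0 i.
Proof.
set P := \matrix_(k, j) _.
have adj1 : \adj (1%:M : 'M[A]_n) = 1%:M by rewrite -[LHS]mul1mx mul_mx_adj det1.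
have cofP j : cofactor P i j = (1%:M : 'M[A]_n) j i.
  rewrite -adj1 mxE /cofactor; congr (_ * \det _); apply/matrixP => k l.
  by rewrite !mxE eq_sym (negPf (neq_lift _ _)).
rewrite (expand_det_row _ i) (bigD1 i) //= big1 ?addr0 => [|j ji].
  by rewrite cofP !mxE !eqxx mulr1.
by rewrite cofP !mxE (negPf ji) mulr0.
Qed.

(** The bounds r i are decreased until the matrix of coefficients at the bounds is
    invertible.  If it is singular, a relation c between its rows, multiplied by
    the powers of the variable that bring all rows involved to the largest bound
    among them, cancels the leading coefficients of one row and lowers its bound.
    A row of bound 0 would be replaced by zero, which the nonzero determinant
    excludes; the sum of the bounds is thus a decreasing measure. *)
Lemma row_reduction n (G : 'M[{poly K}]_n) (r : 'I_n -> nat) :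
  \det G != 0 -> (forall i j, size (G i j) <= (r i).+1)%N ->
  exists (P : 'M[{poly K}]_n) (r' : 'I_n -> nat),
    [/\ P \in unitmx, (forall i j, size ((P *m G) i j) <= (r' i).+1)%N &
        \matrix_(i, j) ((P *m G) i j)`_(r' i) \in unitmx].
Proof.
have [N] := ubnP (\sum_i r i); elim: N => // N IH in G r * => ltN dG sG.
pose L := \matrix_(i, j) (G i j)`_(r i).
have [uL|] := boolP (L \in unitmx).
  by exists 1%:M, r; split; rewrite ?unitmx1 ?mul1mx // => i j; rewrite mul1mx.
rewrite unitmxE unitfE negbK => /det0P[c /rV0Pn[i0 ci0] cL].
case: (@arg_maxnP _ i0 (fun i => c 0 i != 0) r ci0) => i ci maxi.
(* The maximality of r i on the support of c makes the exponents r i - r j genuine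
   differences there. *)
pose a : 'rV[{poly K}]_n := \row_j ((c 0 j)%:P * 'X^(r i - r j)).
pose P1 := \matrix_(k, j) (if k == i then a 0 j else (k == j)%:R).
have dP1 : \det P1 = (c 0 i)%:P.
  by rewrite det_replace_row mxE subnn expr0 mulr1.
have uP1 : P1 \in unitmx.
  by rewrite unitmxE dP1 poly_unitE size_polyC ci coefC /= unitfE.
have dG1 : \det (P1 *m G) != 0.
  by rewrite det_mulmx mulf_neq0 // dP1 polyC_eq0.
have rowk k l : k != i -> (P1 *m G) k l = G k l.
  move=> ki; rewrite mxE (bigD1 k) //= mxE (negPf ki) eqxx mul1r big1 ?addr0 //.
  by move=> j jk; rewrite mxE (negPf ki) eq_sym (negPf jk) mul0r.
have rowi l : (size ((P1 *m G) i l) <= r i)%N.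
  apply/leq_sizeP => q leq.
  rewrite mxE coef_sum.
  have cq j : (P1 i j * G j l)`_q = c 0 j * (G j l)`_(q - (r i - r j)).
    rewrite !mxE eqxx -mulrA coefCM coefXnM; case: ltnP => // h.
    by exfalso; move: leq h; lia.
  under eq_bigr do rewrite cq.
  have [qr|qr] := eqVneq q (r i); last first.
    apply: big1 => j _; have [->|cj] := eqVneq (c 0 j) 0; first by rewrite mul0r.
    rewrite [_`__]nth_default ?mulr0 // (leq_trans (sG _ _)) //.
    have := maxi _ cj; lia.
  have /matrixP/(_ 0 l) := cL; rewrite mxE [RHS]mxE; apply: etrans.
  apply: eq_bigr => j _; have [->|cj] := eqVneq (c 0 j) 0; first by rewrite !mul0r.
  by rewrite mxE qr subKn //; apply: maxi.
have ri : (0 < r i)%N.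
  rewrite lt0n; apply: contraNneq dG1 => ri0; rewrite (expand_det_row _ i).
  apply/eqP; apply: big1 => l _; have := rowi l.
  by rewrite ri0 leqn0 size_poly_eq0 => /eqP ->; rewrite mul0r.
pose r1 k := if k == i then (r i).-1 else r k.
have ltr : (\sum_k r1 k < N)%N.
  move: ltN; rewrite (bigD1 i) //= [in X in _ -> X](bigD1 i) //= /r1 eqxx.
  under [in X in _ -> X]eq_bigr => k ki do rewrite (negPf ki).
  lia.
have [k l|P [r' [uP sP lP]]] := IH _ _ ltr dG1.
  rewrite /r1; case: eqVneq => [->|ki]; first by rewrite prednK.
  by rewrite rowk.
by exists (P *m P1), r'; rewrite -mulmxA; split=> //; rewrite unitmx_mul uP.
Qed.

(** Euclid's algorithm on the entries of v: divide all entries by one of them,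
    and start again with a nonzero remainder as long as there is one. *)
Lemma column_reduction n (v : 'cV[{poly K}]_n.+1) :
  exists (U : 'M[{poly K}]_n.+1) (g : {poly K}),
    U \in unitmx /\ U *m v = g *: delta_mx 0 0.
Proof.
have [->|/cV0Pn[i vi]] := eqVneq v 0.
  by exists 1%:M, 0; rewrite unitmx1 mulmx0 scale0r.
have [N] := ubnP (size (v i 0)); elim: N => // N IH in v i vi * => ltN.
pose w := xrow 0 i v.
have w0 : w 0 0 = v i 0 by rewrite !mxE tpermL.
pose U1 : 'M[{poly K}]_n.+1 := \matrix_(k, j)
  ((k == j)%:R - (if (j == 0) && (k != 0) then w k 0 %/ w 0 0 else 0)).
have uU1 : U1 \in unitmx.
  rewrite unitmxE det_trig; last first.
    apply/is_trig_mxP => k j kj; rewrite mxE.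
    have /negPf -> : k != j by rewrite neq_ltn kj.
    suff /negPf -> : j != 0 by rewrite subr0.
    by apply: contraTneq kj => ->.
  rewrite big1 ?unitr1 // => k _; rewrite mxE eqxx.
  by case: eqP => //= _; rewrite subr0.
have U1w k : (U1 *m w) k 0 = if k == 0 then w 0 0 else w k 0 %% w 0 0.
  rewrite mxE.
  under eq_bigr => j _ do rewrite mxE mulrBl.
  rewrite sumrB (bigD1 k) //= eqxx mul1r [in X in _ + X - _]big1 => [|j jk]; last first.
    by rewrite eq_sym (negPf jk) mul0r.
  rewrite addr0 (bigD1 0) //= [in X in _ - (_ + X)]big1 => [|j j0]; last first.
    by rewrite (negPf j0) mul0r.
  rewrite addr0; case: eqVneq => [->|k0] /=; first by rewrite mul0r subr0.
  by rewrite {1}(divp_eq (w k 0) (w 0 0)) addrC addKr.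
pose T := U1 *m (tperm_mx 0 i : 'M[{poly K}]_n.+1).
have uT : T \in unitmx by rewrite unitmx_mul uU1 unitmx_perm.
have Tv : T *m v = U1 *m w by rewrite -mulmxA -xrowE.
have [/forallP h|] := boolP [forall k, (k == 0) || (w k 0 %% w 0 0 == 0)].
  exists T, (w 0 0); split => //; rewrite Tv; apply/matrixP => k j.
  rewrite ord1 U1w [RHS]mxE [delta_mx _ _ _ _]mxE eqxx andbT; have := h k.
  by case: eqP => /= [_|_ /eqP ->]; rewrite ?mulr1 ?mulr0.
rewrite negb_forall => /existsP[k]; rewrite negb_or => /andP[k0 rk].
have [||U [g [uU Ug]]] := IH (T *m v) k.
- by rewrite Tv U1w (negPf k0).
- rewrite Tv U1w (negPf k0); rewrite -ltnS.
  by apply: leq_ltn_trans ltN; rewrite w0 ltn_modp.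
by exists (U *m T), g; rewrite unitmx_mul uU -mulmxA.
Qed.

End PolyMatrices.

(** * Charts, Laurent functions and monomials *)

HB.instance Definition _ (K : closedFieldType) :=
  GRing.RMorphism.copy (@chart0 K) (@FracField.tofrac {poly K}).
HB.instance Definition _ (K : closedFieldType) :=
  GRing.RMorphism.copy (@chart1 K)
    (horner_eval (xcoord K)^-1 \o map_poly (@FracField.tofrac {poly K} \o polyC)).

Section Charts.
Variable K : closedFieldType.
Local Notation F := (ratfun K).
Local Notation x := (xcoord K).
Local Notation c0 := (@chart0 K).
Local Notation c1 := (@chart1 K).
Implicit Types (p q : {poly K}) (c : K) (f : F).

Lemma chart0_inj : injective c0.
Proof. by move=> p q /eqP; rewrite /chart0 tofrac_eq => /eqP. Qed.

Lemma chart0_eq0 p : (c0 p == 0) = (p == 0).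
Proof. by rewrite /chart0 tofrac_eq0. Qed.

Lemma xcoord_neq0 : x != 0.
Proof. by rewrite /xcoord tofrac_eq0 polyX_eq0. Qed.

Lemma xcoordX_neq0 i : x ^+ i != 0.
Proof. exact: expf_neq0 xcoord_neq0. Qed.

Lemma chart0Xn i : c0 'X^i = x ^+ i.
Proof. by rewrite rmorphXn. Qed.

Lemma chart1C c : c1 c%:P = c0 c%:P.
Proof.
by rewrite /chart1 (map_polyC (@FracField.tofrac {poly K} \o polyC)) hornerC.
Qed.

Lemma chart1X : c1 'X = x^-1.
Proof.
by rewrite /chart1 (map_polyX (@FracField.tofrac {poly K} \o polyC)) hornerX.
Qed.

Lemma chart1Xn i : c1 'X^i = x ^- i.
Proof. by rewrite rmorphXn /= chart1X exprVn. Qed.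

(** Multiplying p(1/x) by x^N reverses the coefficients of p; this turns
    questions about the chart at infinity into questions about polynomials in x. *)
Lemma chart1_rev N p : (size p <= N.+1)%N ->
  c1 p * x ^+ N = c0 (\poly_(i < N.+1) p`_(N - i)).
Proof.
move=> sp.
have def_p : p = \sum_(i < N.+1) p`_i *: 'X^i.
  by rewrite -poly_def; apply/polyP => i; rewrite coef_poly; case: ltnP => // h;
     rewrite nth_default // (leq_trans sp).
rewrite {1}def_p poly_def !raddf_sum /= mulr_suml.
rewrite [RHS](reindex_inj rev_ord_inj) /=.
apply: eq_bigr => i _.
have le_i : (i <= N)%N by rewrite -ltnS.
rewrite -!mul_polyC !rmorphM /= chart1C chart1Xn chart0Xn -mulrA subSS subKn //.
congr (_ * _).
have -> : x ^+ N = x ^+ (N - i) * x ^+ i by rewrite -exprD subnK.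
by rewrite mulrCA mulVf ?mulr1 // xcoordX_neq0.
Qed.

Lemma chart1_inj : injective c1.
Proof.
apply: raddf_inj => p /eqP p0; apply/eqP.
have := @chart1_rev (size p) p (leqnSn _); rewrite (eqP p0) mul0r => /esym/eqP.
rewrite chart0_eq0 => /eqP h; apply/eqP/polyP => i; rewrite coef0.
have [hi|hi] := ltnP i (size p); last by rewrite nth_default.
have := congr1 (fun q => q`_(size p - i)) h.
by rewrite coef_poly coef0 ltnS leq_subr subKn // ltnW.
Qed.

Lemma chart1_eq0 p : (c1 p == 0) = (p == 0).
Proof. by rewrite -(inj_eq chart1_inj) rmorph0. Qed.

Lemma xcoordXz_neq0 (e : int) : x ^ e != 0.
Proof. by rewrite expfz_eq0 negb_and xcoord_neq0 orbT. Qed.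

Lemma xcoordXzD (e e' : int) : x ^ (e + e') = x ^ e * x ^ e'.
Proof. exact: expfzDr xcoord_neq0. Qed.

(** Comparison of degrees in x: the left-hand side has degree at least u, and the
    right-hand side has degree at most v. *)
Lemma degree_le (p0 p1 : {poly K}) (u v : int) : p0 != 0 ->
  c0 p0 * x ^ u = x ^ v * c1 p1 -> u <= v.
Proof.
move=> p0n0 h.
pose N := size p1; pose M := (`|u|%N + `|v|%N)%N.
pose r := \poly_(i < N.+1) p1`_(N - i).
have hr : c1 p1 * x ^+ N = c0 r by apply: chart1_rev.
have [nu hu] : exists i : nat, u + M%:Z = i%:Z by exists (absz (u + M%:Z)); lia.
have [nv hv] : exists i : nat, v + M%:Z = i%:Z by exists (absz (v + M%:Z)); lia.
have e : p0 * 'X^(nu + N) = r * 'X^nv.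
  apply: chart0_inj; rewrite !rmorphM /= !chart0Xn -hr exprD.
  rewrite !exprnP -hu -hv !xcoordXzD.
  by rewrite !mulrA h [x ^ v * c1 p1]mulrC -!mulrA; congr (_ * _); rewrite mulrA mulrC.
have := congr1 (fun q : {poly K} => size q) e.
have r0 : r != 0.
  apply: contra_neq p0n0 => r0; move/eqP: e; rewrite r0 mul0r mulf_eq0.
  by rewrite expf_eq0 polyX_eq0 andbF orbF => /eqP.
rewrite !size_mulXn //.
have sr : (size r <= N.+1)%N by apply: size_poly.
have : (0 < size p0)%N by rewrite lt0n size_poly_eq0.
lia.
Qed.

Lemma unit_poly_const p : p \is a GRing.unit -> exists2 c, c != 0 & p = c%:P.
Proof.
rewrite poly_unitE => /andP[/eqP s1]; rewrite unitfE => h.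
by exists p`_0 => //; apply: size1_polyC; rewrite s1.
Qed.

Lemma const_unit c : c != 0 -> c%:P \is a GRing.unit :> bool.
Proof. by move=> c0'; rewrite poly_unitE size_polyC c0' coefC /= unitfE. Qed.

(** The nonzero monomials are the units of the ring of Laurent polynomials.  By
    definition, a bundle has degree e when the determinant of its transition
    matrix satisfies [monomial e]. *)
Definition monomial (e : int) (f : F) : Prop :=
  exists2 c : K, c != 0 & f = c0 c%:P * x ^ e.

Lemma monomial_neq0 e f : monomial e f -> f != 0.
Proof.
by move=> [c cn0 ->]; rewrite mulf_neq0 ?xcoordXz_neq0 // chart0_eq0 polyC_eq0.
Qed.

Lemma monomialM e e' f f' : monomial e f -> monomial e' f' -> monomial (e + e') (f * f').
Proof.
move=> [c cn0 ->] [c' cn0' ->]; exists (c * c'); first by rewrite mulf_neq0.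
by rewrite polyCM rmorphM xcoordXzD mulrACA.
Qed.

Lemma monomialV e f : monomial e f -> monomial (- e) f^-1.
Proof.
move=> [c cn0 ->]; exists c^-1; first by rewrite invr_neq0.
rewrite invfM invr_expz; congr (_ * _).
apply: (mulfI (x := c0 c%:P)); first by rewrite chart0_eq0 polyC_eq0.
by rewrite -rmorphM -polyCM !mulfV ?chart0_eq0 ?polyC_eq0 // !rmorph1.
Qed.

Lemma monomial_expz e : monomial e (x ^ e).
Proof. by exists 1; rewrite ?oner_neq0 // rmorph1 mul1r. Qed.

(** A nonzero map from O(e) to O(e') forces e <= e'. *)
Lemma monomial_le e f f' (p p' : {poly K}) e' : monomial e f -> monomial e' f' ->
  p != 0 -> f * c0 p = f' * c1 p' -> e <= e'.
Proof.
move=> [c cn0 ->] [c' cn0' ->] pn0 h.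
apply: (@degree_le (c%:P * p) (c'%:P * p')).
  by rewrite mulf_neq0 ?polyC_eq0.
by rewrite !rmorphM /= chart1C mulrAC h mulrCA mulrA.
Qed.

Lemma laurent0 : laurent (0 : F).
Proof. by exists 0, 0%N; rewrite rmorph0 mul0r. Qed.

Lemma laurent_chart0 p : laurent (c0 p).
Proof. by exists p, 0%N; rewrite expr0 divr1. Qed.

Lemma laurentM f g : laurent f -> laurent g -> laurent (f * g).
Proof.
move=> [p [N ->]] [q [M ->]]; exists (p * q), (N + M)%N.
by rewrite rmorphM exprD /= mulf_div.
Qed.

Lemma laurentD f g : laurent f -> laurent g -> laurent (f + g).
Proof.
move=> [p [N ->]] [q [M ->]]; exists (p * 'X^M + q * 'X^N), (N + M)%N.
rewrite rmorphD !rmorphM /= !chart0Xn exprD.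
by rewrite addf_div ?xcoordX_neq0.
Qed.

Lemma laurent_expz e : laurent (x ^ e).
Proof.
case: e => n; first by exists 'X^n, 0%N; rewrite chart0Xn expr0 divr1.
by exists 1, n.+1; rewrite rmorph1 NegzE div1r.
Qed.

Lemma laurent_chart1 p : laurent (c1 p).
Proof.
have /(congr1 (fun f => f / x ^+ size p)) := @chart1_rev (size p) p (leqnSn _).
rewrite mulfK ?xcoordX_neq0 // => ->.
by exists (\poly_(i < (size p).+1) p`_(size p - i)), (size p).
Qed.

Lemma laurent_sum (I : Type) (r : seq I) (P : pred I) (g : I -> F) :
  (forall i, P i -> laurent (g i)) -> laurent (\sum_(i <- r | P i) g i).
Proof. by move=> h; apply: big_ind => //; [exact: laurent0|exact: laurentD]. Qed.

Lemma laurent_prod (I : Type) (r : seq I) (P : pred I) (g : I -> F) :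
  (forall i, P i -> laurent (g i)) -> laurent (\prod_(i <- r | P i) g i).
Proof.
move=> h; apply: big_ind => //; last exact: laurentM.
by rewrite -[1](rmorph1 c0); apply: laurent_chart0.
Qed.

Definition laurent_mx m n (M : 'M[F]_(m, n)) := forall i j, laurent (M i j).

Lemma laurent_mulmx m n k (A : 'M_(m, n)) (B : 'M_(n, k)) :
  laurent_mx A -> laurent_mx B -> laurent_mx (A *m B).
Proof.
by move=> hA hB i j; rewrite mxE; apply: laurent_sum => l _; apply: laurentM.
Qed.

Lemma laurent_map0 m n (A : 'M_(m, n)) : laurent_mx (map_mx c0 A).
Proof. by move=> i j; rewrite mxE; apply: laurent_chart0. Qed.

Lemma laurent_map1 m n (A : 'M_(m, n)) : laurent_mx (map_mx c1 A).
Proof. by move=> i j; rewrite mxE; apply: laurent_chart1. Qed.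

Lemma laurentN1Xn i : laurent ((-1) ^+ i : F).
Proof.
by rewrite -(rmorph1 c0) -(rmorphN c0) -rmorphXn; apply: laurent_chart0.
Qed.

Lemma laurent_det n (A : 'M_n) : laurent_mx A -> laurent (\det A).
Proof.
move=> h; apply: laurent_sum => s _; apply: laurentM; first exact: laurentN1Xn.
by apply: laurent_prod.
Qed.

(** By Cramer's rule, with a monomial as determinant. *)
Lemma laurent_inv n (A : 'M_n) e : laurent_mx A -> monomial e (\det A) ->
  laurent_mx (invmx A).
Proof.
move=> hA /monomialV[c _ hd] i j; rewrite /invmx; case: ifP => // _.
rewrite !mxE hd; apply: laurentM.
  by apply: laurentM; [exact: laurent_chart0 | exact: laurent_expz].
apply: laurentM; first exact: laurentN1Xn.
by apply: laurent_det => k l; rewrite !mxE.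
Qed.

(** All bundles below are built from a transition matrix by this criterion. *)
Lemma bundle_of_det n (A : 'M_n) e : laurent_mx A -> monomial e (\det A) ->
  exists2 E : vector_bundle K n, transition E = A & has_degree E e.
Proof.
move=> hA hd.
have uA : A \in unitmx by rewrite unitmxE unitfE (monomial_neq0 hd).
by exists (VectorBundle uA hA (laurent_inv hA hd)).
Qed.

(** After clearing denominators, this is the fact that the divisors of a power of
    X are powers of X up to a constant. *)
Lemma laurent_monomial_factor f g e : laurent f -> laurent g ->
  monomial e (f * g) -> exists e', monomial e' f.
Proof.
move=> [p [N ->]] [q [M ->]] [c cn0 h].
have hpq : c0 p * c0 q = c0 c%:P * x ^ e * x ^+ (N + M).
  by rewrite -h mulf_div -exprD divfK ?xcoordX_neq0.
have [k hk] : exists k : nat, e + (N + M)%N%:Z + `|e|%N%:Z = k%:Z.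
  by exists (absz (e + (N + M)%N%:Z + `|e|%N%:Z)); lia.
have : p %| 'X^k.
  have -> : 'X^k = p * (q * 'X^`|e| * c^-1%:P).
    apply: chart0_inj; rewrite !mulrA !rmorphM /= !chart0Xn hpq.
    have cc : c0 c%:P * c0 c^-1%:P = 1.
      by rewrite -rmorphM -polyCM mulfV // !rmorph1.
    by rewrite !exprnP -hk !xcoordXzD [RHS]mulrC !mulrA [_ * c0 c%:P]mulrC cc mul1r.
  exact: dvdp_mulIl.
rewrite -['X]subr0 -polyC0 => /dvdp_exp_XsubCP[i _]; rewrite polyC0 subr0.
move=> /eqpP[[a b] /= /andP[an0 bn0] hab].
have -> : p = (a^-1 * b)%:P * 'X^i.
  by rewrite mul_polyC -scalerA -hab scalerA mulVf // scale1r.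
exists (i%:Z - N%:Z); exists (a^-1 * b); first by rewrite mulf_neq0 // invr_neq0.
by rewrite rmorphM /= chart0Xn xcoordXzD -invr_expz mulrA.
Qed.

End Charts.

(** * Frames of a bundle, splitting and saturation *)

Section BirkhoffGrothendieck.
Variable K : closedFieldType.
Local Notation F := (ratfun K).
Local Notation x := (xcoord K).
Local Notation c0 := (@chart0 K).
Local Notation c1 := (@chart1 K).

Lemma monomial_det0 n (U : 'M[{poly K}]_n) : U \in unitmx ->
  monomial 0 (\det (map_mx c0 U)).
Proof.
rewrite unitmxE => /unit_poly_const[c cn0 h]; exists c => //.
by rewrite det_map_mx h expr0z mulr1.
Qed.

Lemma monomial_det1 n (U : 'M[{poly K}]_n) : U \in unitmx ->
  monomial 0 (\det (map_mx c1 U)).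
Proof.
rewrite unitmxE => /unit_poly_const[c cn0 h]; exists c => //.
by rewrite det_map_mx h expr0z mulr1 /= chart1C.
Qed.

(** New trivialisations over the two charts change neither the regularity of the
    transition matrix nor its degree, because the determinants of the two
    changes of basis are constants. *)
Lemma change_frame n (P Q : 'M[{poly K}]_n) (g T : 'M[F]_n) d :
  P \in unitmx -> Q \in unitmx -> map_mx c0 P *m g = T *m map_mx c1 Q ->
  laurent_mx g -> monomial d (\det g) ->
  laurent_mx T /\ monomial d (\det T).
Proof.
move=> uP uQ h lg dg.
have defT : T = map_mx c0 P *m g *m map_mx c1 (invmx Q).
  by rewrite h -mulmxA -map_mxM mulmxV // map_mx1 mulmx1.
have uQ' : invmx Q \in unitmx by rewrite unitmx_inv.
split; rewrite defT.
  do 2?apply: laurent_mulmx => //; [exact: laurent_map0|exact: laurent_map1].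
rewrite !det_mulmx -[d]add0r -[0 + d]addr0.
exact: monomialM (monomialM (monomial_det0 uP) dg) (monomial_det1 uQ').
Qed.

Definition xdiag n (a : 'I_n -> int) : 'M[F]_n := diag_mx (\row_i x ^ a i).

Lemma xdiagE n (a : 'I_n -> int) i j : xdiag a i j = x ^ a i *+ (i == j).
Proof. by rewrite !mxE; case: eqP => // ->. Qed.

Lemma det_xdiag n (a : 'I_n -> int) : \det (xdiag a) = x ^ (\sum_i a i).
Proof.
rewrite det_diag (big_morph _ (xcoordXzD K) (expr0z x)).
by apply: eq_bigr => i _; rewrite mxE.
Qed.

Lemma laurent_xdiag n (a : 'I_n -> int) : laurent_mx (xdiag a).
Proof.
move=> i j; rewrite xdiagE; case: eqP => _; last exact: laurent0.
exact: laurent_expz.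
Qed.

Lemma laurent_common n (h : 'M[F]_n) : laurent_mx h ->
  exists (G : 'M[{poly K}]_n) (N : nat), map_mx c0 G = x ^+ N *: h.
Proof.
move=> lh.
have /fin_all_exists[f hf] : forall ij : 'I_n * 'I_n, exists pN : {poly K} * nat,
    h ij.1 ij.2 = c0 pN.1 / x ^+ pN.2.
  by move=> ij; have [p [N e]] := lh ij.1 ij.2; exists (p, N).
pose N := (\max_ij (f ij).2)%N.
exists (\matrix_(i, j) ((f (i, j)).1 * 'X^(N - (f (i, j)).2))), N.
apply/matrixP => i j; rewrite !mxE (hf (i, j)) rmorphM /= chart0Xn.
have le : ((f (i, j)).2 <= N)%N by apply: (leq_bigmax (i, j)).
by rewrite -{2}(subnK le) exprD mulrCA -mulrA divff ?xcoordX_neq0 // mulr1 mulrC.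
Qed.

(** Clear denominators and row-reduce over K[x], to row degrees r i.  Dividing row
    i by x^(r i) leaves a matrix of polynomials in y, and its value at y = 0 is
    the matrix of leading coefficients, which is invertible.  Its determinant is
    thus a monomial in y that does not vanish at 0, hence a constant, and the
    matrix is invertible over K[y]. *)
Lemma birkhoff_grothendieck n (h : 'M[F]_n) e :
  laurent_mx h -> monomial e (\det h) ->
  exists (P Q : 'M[{poly K}]_n) (a : 'I_n -> int),
    [/\ P \in unitmx, Q \in unitmx,
        map_mx c0 P *m h = xdiag a *m map_mx c1 Q & \sum_i a i = e].
Proof.
move=> lh dh.
have [G [N hG]] := laurent_common lh.
have dG : \det G != 0.
  rewrite -chart0_eq0 -det_map_mx hG detZ mulf_neq0 ?(monomial_neq0 dh) //.
  by rewrite expf_eq0 negb_and xcoordX_neq0 orbT.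
have szG i j : (size (G i j) <= (\max_ij size (G ij.1 ij.2)).+1)%N.
  exact: leqW (leq_bigmax (i, j)).
have [P [r [uP sP uL]]] := row_reduction dG szG.
(* Row i divided by x^(r i), written in y: the coefficients are reversed. *)
pose Q := \matrix_(i, j) \poly_(k < (r i).+1) ((P *m G) i j)`_(r i - k).
pose a i := (r i)%:Z - N%:Z.
have PQ : map_mx c0 P *m h = xdiag a *m map_mx c1 Q.
  have : map_mx c0 (P *m G) = x ^+ N *: (map_mx c0 P *m h).
    by rewrite map_mxM hG -scalemxAr.
  move=> hPG; apply: (scalerI (xcoordX_neq0 K N)); rewrite -{}hPG.
  have ar i : x ^+ N * x ^ a i = x ^+ r i.
    by rewrite !exprnP -xcoordXzD /a addrC subrK.
  apply/matrixP => i j; rewrite mul_diag_mx [LHS]mxE [RHS]mxE [in RHS]mxE.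
  rewrite [(\row__ _) _ _]mxE [map_mx _ _ _ _]mxE [Q i j]mxE mulrA ar mulrC.
  rewrite chart1_rev ?size_poly //; congr c0; apply/polyP => k.
  rewrite coef_poly; case: ltnP => k_r.
    by rewrite coef_poly ltnS leq_subr subKn.
  by rewrite nth_default // (leq_trans _ k_r).
have dQ0 : (\det Q).[0] != 0.
  rewrite -[_.[0]]/(horner_eval 0 _) -det_map_mx.
  rewrite unitmxE unitfE in uL; apply: contra_neq uL; apply: etrans; congr (\det _).
  apply/matrixP => i j; rewrite [RHS]mxE [LHS]mxE [Q i j]mxE /= /horner_eval.
  by rewrite horner_coef0 coef_poly subn0.
have [c cn0 dQ] : monomial (e - \sum_i a i) (\det (map_mx c1 Q)).
  have -> : \det (map_mx c1 Q) = \det (map_mx c0 P) * \det h * (\det (xdiag a))^-1.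
    by rewrite -det_mulmx PQ det_mulmx det_xdiag mulrAC divff ?mul1r ?xcoordXz_neq0.
  rewrite -[e]add0r; apply: monomialM; first exact: monomialM (monomial_det0 uP) dh.
  by rewrite det_xdiag; apply/monomialV/monomial_expz.
rewrite det_map_mx in dQ.
(* The determinant of Q is c x^v with v = e - \sum_i a i; being a polynomial in y
   it has v <= 0, and a nonzero value at y = 0 excludes v < 0. *)
have : e - \sum_i a i <= 0.
  apply: (@degree_le _ c%:P (\det Q)); first by rewrite polyC_eq0.
  by rewrite expr0z mul1r.
case E : (e - \sum_i a i) dQ => [k|k] dQ => [|_].
  case: k E dQ => // E dQ _; exists P, Q, a; split=> //; last by lia.
  rewrite unitmxE; move: dQ; rewrite expr0z mulr1 -chart1C.
  by move/chart1_inj ->; apply: const_unit.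
move: dQ; rewrite NegzE -invr_expz -chart1C -exprnP -chart1Xn -rmorphM.
by move/chart1_inj => dQ; move: dQ0; rewrite dQ hornerM hornerXn expr0n mulr0 eqxx.
Qed.

(** Column reduction of s0 and s1 gives frames in which the section is a multiple
    of the first basis vector, g0 over one chart and g1 over the other.  Then the
    first column of the transition matrix is (q, 0), where q defines the line
    subbundle O(e) generated by the section, and h defines the quotient bundle.
    The degree e is not negative because the section is a section of O(e). *)
Lemma saturate p (g : 'M[F]_(1 + p)) d (s0 s1 : 'cV[{poly K}]_(1 + p)) :
  laurent_mx g -> monomial d (\det g) ->
  map_mx c0 s0 = g *m map_mx c1 s1 -> s0 != 0 ->
  exists (U0 U1 : 'M[{poly K}]_(1 + p)) (g0 g1 : {poly K}) (q : F) (e : int)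
     (w : 'rV[F]_p) (h : 'M[F]_p),
  [/\ [/\ U0 \in unitmx, U1 \in unitmx,
        U0 *m s0 = col_mx g0%:M 0 & U1 *m s1 = col_mx g1%:M 0],
      map_mx c0 U0 *m g = block_mx q%:M w 0 h *m map_mx c1 U1,
      [/\ monomial e q, 0 <= e & c0 g0 = q * c1 g1] &
      laurent_mx h /\ monomial (d - e) (\det h)].
Proof.
move=> lg dg hs s0n0.
have delta_col (f : {poly K}) :
    f *: (delta_mx 0 0 : 'cV_(1 + p)) = col_mx f%:M 0.
  apply/matrixP => i j; rewrite ord1 !mxE; case: splitP => k hk.
    have -> : i = 0 by apply/val_inj; rewrite /= hk ord1.
    by rewrite !mxE ord1 !eqxx mulr1.
  rewrite mxE; have /negPf -> : i != 0 by rewrite -(inj_eq val_inj) /= hk.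
  by rewrite mulr0.
have [U0 [g0 [uU0 hU0]]] := column_reduction (s0 : 'cV_(p.+1)).
have [U1 [g1 [uU1 hU1]]] := column_reduction (s1 : 'cV_(p.+1)).
rewrite delta_col in hU0; rewrite delta_col in hU1.
have [T TU1] : exists T : 'M_(1 + p), map_mx c0 U0 *m g = T *m map_mx c1 U1.
  exists (map_mx c0 U0 *m g *m map_mx c1 (invmx U1)).
  by rewrite -!mulmxA -map_mxM mulVmx // map_mx1 mulmx1.
have [lT dT] := change_frame uU0 uU1 TU1 lg dg.
have Tg : T *m map_mx c1 (col_mx g1%:M 0) = map_mx c0 (col_mx g0%:M 0).
  by rewrite -hU1 -hU0 !map_mxM hs !mulmxA TU1.
have g0n0 : g0 != 0.
  apply: contra_neq s0n0 => g00; move: hU0; rewrite g00 raddf0 col_mx0 => h.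
  by rewrite -[s0](mulKmx uU0) h mulmx0.
pose q := ulsubmx T 0 0.
have ulT : ulsubmx T = q%:M by rewrite [LHS]mx11_scalar.
move: Tg; rewrite -[T]submxK !map_col_mx mul_block_col !map_mx0 !mulmx0 !addr0.
rewrite !map_scalar_mx ulT -scalar_mxM => /eq_col_mx[hq hdl].
have /matrixP/(_ 0 0) := hq; rewrite !mxE eqxx !mulr1n /= => {}hq.
(* The first column of T times g1 is (g0, 0), so the rest of that column is zero
   once g1 is not. *)
have g1n0 : c1 g1 != 0.
  by apply: contra_neq g0n0 => g10; apply/eqP; rewrite -chart0_eq0 -hq g10 mulr0.
have dlT : dlsubmx T = 0.
  by apply: (scalerI g1n0); rewrite scaler0 -mul_mx_scalar.
have TE : T = block_mx q%:M (ursubmx T) 0 (drsubmx T).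
  by rewrite -[LHS]submxK ulT dlT.
have lul : laurent q by rewrite /q !mxE; apply: lT.
have lh : laurent_mx (drsubmx T) by move=> i j; rewrite !mxE; apply: lT.
have dTE : \det T = q * \det (drsubmx T).
  by rewrite TE det_ublock det_scalar1 block_mxKdr.
have [|e mq] := laurent_monomial_factor (e := d) lul (laurent_det lh).
  by rewrite -dTE.
exists U0, U1, g0, g1, q, e, (ursubmx T), (drsubmx T); split=> //.
- by rewrite -TE.
- split=> //; have := monomial_le (p' := g1) (monomial_expz K 0) mq g0n0.
  by apply; rewrite expr0z mul1r hq.
- split=> //.
  have -> : \det (drsubmx T) = \det T * q^-1.
    by rewrite dTE mulrAC divff ?mul1r ?(monomial_neq0 mq).
  exact: monomialM dT (monomialV mq).
Qed.

End BirkhoffGrothendieck.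

(** * Subbundles cut out by adapted frames *)

Section Subbundles.
Variable K : closedFieldType.
Local Notation F := (ratfun K).
Local Notation x := (xcoord K).
Local Notation c0 := (@chart0 K).
Local Notation c1 := (@chart1 K).

Lemma rank_colsub_unit (L : fieldType) n n' (f : 'I_n' -> 'I_n) (M : 'M[L]_n) :
  injective f -> M \in unitmx -> \rank (colsub f M) = n'.
Proof.
move=> inj_f uM; apply/eqP/row_fullP; exists (rowsub f (invmx M)).
by rewrite -mxsub_mul mulVmx //; apply/matrixP => i j; rewrite !mxE (inj_eq inj_f).
Qed.

Lemma unitmx_eval n (P : 'M[{poly K}]_n) (u : K) :
  P \in unitmx -> map_mx (fun p : {poly K} => p.[u]) P \in unitmx.
Proof.
move=> uP; have := congr1 (map_mx (horner_eval u)) (mulmxV uP).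
by rewrite map_mxM map_mx1 => /mulmx1_unit[].
Qed.

(** Only the columns of A that meet a nonzero row of B contribute to the product. *)
Lemma colsub_mul_rowsub (L : pzSemiRingType) m n n' k (f : 'I_n' -> 'I_n)
    (A : 'M[L]_(m, n)) (B : 'M[L]_(n, k)) :
  injective f -> (forall i j, i \notin codom f -> B i j = 0) ->
  colsub f A *m rowsub f B = A *m B.
Proof.
move=> inj_f B0; apply/matrixP => i j; rewrite !mxE [RHS](bigID (mem (codom f))) /=.
rewrite [X in _ = _ + X]big1 ?addr0 => [|l lf]; last by rewrite B0 // mulr0.
have uf : uniq (codom f) by rewrite map_inj_uniq ?enum_uniq.
by rewrite -(big_uniq _ uf) big_image /=; apply: eq_bigr => l _; rewrite !mxE.
Qed.

(** The same change of frames, read in the other direction. *)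
Lemma frame_inv n (P Q : 'M[{poly K}]_n) (g T : 'M[F]_n) :
  P \in unitmx -> Q \in unitmx -> map_mx c0 P *m g = T *m map_mx c1 Q ->
  map_mx c0 (invmx P) *m T = g *m map_mx c1 (invmx Q).
Proof.
move=> uP uQ h; rewrite -[LHS]mulmx1 -(map_mx1 c1) -(mulmxV uQ) map_mxM mulmxA.
congr (_ *m _).
by rewrite -mulmxA -h mulmxA -map_mxM mulVmx // map_mx1 mul1mx.
Qed.

(** If the columns of the transition matrix T indexed by f have zeros outside the
    rows indexed by f, the basis vectors indexed by f span a subbundle.  It is a
    subbundle in the strong sense because the columns of an invertible matrix are
    independent on every fibre. *)
Lemma frame_subbundle n n' (E : vector_bundle K n) (P Q : 'M[{poly K}]_n)
    (T : 'M[F]_n) (f : 'I_n' -> 'I_n) d d' :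
  P \in unitmx -> Q \in unitmx ->
  map_mx c0 P *m T = transition E *m map_mx c1 Q ->
  injective f -> (forall i j, i \notin codom f -> T i (f j) = 0) ->
  has_degree E d -> monomial d' (\det (mxsub f f T)) ->
  exists E' : vector_bundle K n', [/\ has_degree E' d',
    transition E' = mxsub f f T & is_subbundle E' E (colsub f P, colsub f Q)].
Proof.
move=> uP uQ PT inj_f T0 dE dT.
have lT : laurent_mx T.
  have uP' : invmx P \in unitmx by rewrite unitmx_inv.
  have uQ' : invmx Q \in unitmx by rewrite unitmx_inv.
  exact: proj1 (change_frame uP' uQ' (frame_inv uP uQ PT) (@transition_laurent _ _ E) dE).
have lT' : laurent_mx (mxsub f f T) by move=> i j; rewrite mxE; apply: lT.
have [E' tE' dE'] := bundle_of_det lT' dT.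
exists E'; split => //; split.
  rewrite /is_hom /= tE' !map_mxsub mulmx_colsub -PT -mulmx_colsub.
  have -> : mxsub f f T = rowsub f (colsub f T) by apply/matrixP => i j; rewrite !mxE.
  by apply: colsub_mul_rowsub => // i j ij; rewrite mxE T0.
move=> u; split; rewrite /= map_mxsub; apply: rank_colsub_unit => //.
  exact: unitmx_eval.
exact: unitmx_eval.
Qed.

Lemma has_dim1 n (V : set (section_data K n)) : has_dim V 1 ->
  exists2 s, s != 0 & V = [set t | exists c : K, t = c%:P *: s].
Proof.
move=> [b [free_b ->]]; exists (b ord0).
  apply: contra_neq (oner_neq0 K) => b0; apply: (free_b (fun=> 1) _ ord0).
  by rewrite big_ord1 b0 scaler0.
apply/seteqP; split=> t /= [c ->].
  by exists (c ord0); rewrite big_ord1.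
by exists (fun=> c); rewrite big_ord1.
Qed.

Lemma has_dim1I n (s : section_data K n) : s != 0 ->
  has_dim [set t | exists c : K, t = c%:P *: s] 1.
Proof.
move=> s0; exists (fun=> s); split=> [c|].
  rewrite big_ord1 => /eqP h i; rewrite ord1; apply/eqP.
  apply: contraTT h => ci; apply: contraNneq s0 => h.
  have := congr1 (fun t => (c ord0)^-1%:P *: t) h.
  by rewrite scaler0 scalerA -polyCM mulVf // scale1r => ->.
apply/seteqP; split=> t /= [c ->]; first by exists (fun=> c); rewrite big_ord1.
by exists (c ord0); rewrite big_ord1.
Qed.

Lemma subspace_line n (s : section_data K n) :
  subspace [set t | exists c : K, t = c%:P *: s].
Proof.
split; first by exists 0; rewrite scale0r.
move=> c t u [a ->] [b ->]; exists (c * a + b).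
by rewrite polyCD polyCM scalerDl scalerA.
Qed.

Lemma global_sectionsZ n (E : vector_bundle K n) s (c : K) :
  global_sections E s -> global_sections E (c%:P *: s).
Proof.
rewrite /global_sections /= => h.
by rewrite -!mul_scalar_mx !map_mxM !map_scalar_mx /= chart1C !mul_scalar_mx h scalemxAr.
Qed.

(** A subbundle with the zero space of sections is always a proper subsystem, even
    in full rank, because V is not zero. *)
Lemma stable_slope0 (R : realType) (alpha : R) n d (S : coherent_system K n d 1)
    n' d' (E' : vector_bundle K n') A :
  stable alpha S -> (0 < n')%N -> is_subbundle E' (bundle S) A ->
  has_degree E' d' -> slope alpha n' d' 0 < slope alpha n d 1.
Proof.
move=> stS n'0 subA dE'.
have sub0 : subspace [set (0 : section_data K n')].
  by split=> [//|c t u /= -> ->]; rewrite scaler0 addr0.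
have dim0 : has_dim [set (0 : section_data K n')] 0.
  exists (fun=> 0); split=> [c _ [] //|].
  apply/seteqP; split=> t /=; first by move->; exists (fun=> 0); rewrite big_ord0.
  by move=> [c ->]; rewrite big_ord0.
have glob0 : [set (0 : section_data K n')] `<=` global_sections E'.
  by move=> t /= ->; rewrite /global_sections /= !map_mx0 mulmx0.
have A0 : hom_sections A 0 = 0 by rewrite /hom_sections /= !mulmx0.
apply: (stS _ _ _ (CoherentSystem dE' glob0 sub0 dim0) A).
  split=> // t [u /= -> <-]; rewrite A0; exact: (proj1 (sections_subspace S)).
move=> [_ /= h]; have [s s0 Vs] := has_dim1 (sections_dim S).
have : sections S s by rewrite Vs; exists 1; rewrite scale1r.
by rewrite -h => -[u /= -> st]; rewrite -st A0 eqxx in s0.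
Qed.

Lemma stable_slope1 (R : realType) (alpha : R) n d (S : coherent_system K n d 1)
    n' d' (E' : vector_bundle K n') A s' :
  stable alpha S -> (0 < n' < n)%N -> is_subbundle E' (bundle S) A ->
  has_degree E' d' -> global_sections E' s' -> hom_sections A s' != 0 ->
  sections S (hom_sections A s') ->
  slope alpha n' d' 1 < slope alpha n d 1.
Proof.
move=> stS /andP[n'0 n'n] subA dE' gs' As0 SAs.
have s'0 : s' != 0.
  by apply: contra_neq As0 => ->; rewrite /hom_sections /= !mulmx0.
have glob1 : [set t | exists c : K, t = c%:P *: s'] `<=` global_sections E'.
  by move=> t [c ->]; apply: global_sectionsZ.
apply: (stS _ _ _ (CoherentSystem dE' glob1 (subspace_line s') (has_dim1I s'0)) A).
  split=> // t [u [c ->] <-].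
  have -> : hom_sections A (c%:P *: s') = c%:P *: hom_sections A s' + 0.
    by rewrite addr0 /hom_sections /= -!scalemxAr.
  by apply: (proj2 (sections_subspace S)) => //; apply: (proj1 (sections_subspace S)).
by move=> [[_ [B [_ /mulmx1_min]]]]; rewrite leqNgt n'n.
Qed.

Lemma avg_le n (b : 'I_n.+1 -> int) : exists i, n.+1%:Z * b i <= \sum_j b j.
Proof.
case: (@arg_minP _ _ _ ord0 predT b isT) => i _ mini; exists i.
have -> : n.+1%:Z * b i = \sum_(j < n.+1) b i.
  by rewrite sumr_const card_ord -mulr_natl natz.
by apply: ler_sum => j _; apply: mini.
Qed.

Lemma avg_ge n (b : 'I_n.+1 -> int) : exists i, \sum_j b j <= n.+1%:Z * b i.
Proof.
have [i] := avg_le (fun i => - b i); rewrite sumrN mulrN lerN2 => h.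
by exists i.
Qed.

(** A summand of largest degree in a splitting of E. *)
Lemma line_subbundle n (E : vector_bundle K n.+1) d : has_degree E d ->
  exists (e : int) (L : vector_bundle K 1) A, [/\ has_degree L e,
    is_subbundle L E A & d <= n.+1%:Z * e].
Proof.
move=> dE.
have [P [Q [a [uP uQ PQ sa]]]] := birkhoff_grothendieck (@transition_laurent _ _ E) dE.
have [i hi] := avg_ge a.
have uP' : invmx P \in unitmx by rewrite unitmx_inv.
have uQ' : invmx Q \in unitmx by rewrite unitmx_inv.
have [||j k jk|||L [dL _ sL]] := @frame_subbundle _ 1 E (invmx P) (invmx Q)
  (xdiag K a) (fun=> i) d (a i) uP' uQ'.
- exact: frame_inv.
- by move=> j k _; rewrite !ord1.
- rewrite xdiagE; case: eqP jk => // <-; by rewrite codom_f.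
- done.
- by rewrite det_mx11 mxE xdiagE eqxx; apply: monomial_expz.
by exists (a i), L, (colsub (fun=> i) (invmx P), colsub (fun=> i) (invmx Q)); rewrite -sa.
Qed.

(** The section generates a line subbundle of degree e >= 0.  Split the quotient,
    of rank p.+1 and degree d - e, and drop a summand of least degree b: what
    remains is a subbundle containing s, and b is at most the average degree of
    the quotient, so that p.+1 b <= d - e <= d. *)
Lemma corank1_subbundle p (E : vector_bundle K p.+2) d s :
  has_degree E d -> global_sections E s -> s != 0 ->
  exists (b : int) (E' : vector_bundle K p.+1) A s',
    [/\ has_degree E' (d - b), is_subbundle E' E A, p.+1%:Z * b <= d,
        global_sections E' s' & hom_sections A s' = s].
Proof.
move=> dE gs sn0; set g := transition E.
have s1n0 : s.1 != 0.
  apply: contra_neq sn0 => s10; case: s => [t0 t1] /= in gs s10 *.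
  rewrite s10; congr (_, _); move: gs; rewrite /global_sections /= s10 map_mx0.
  move=> /(congr1 (mulmx (invmx g))); rewrite mulmx0 mulKmx ?transition_unit //.
  move=> h; apply/matrixP => i j; apply: (@chart1_inj K).
  by have /matrixP/(_ i j) := h; rewrite !mxE rmorph0.
have [U0 [U1 [g0 [g1 [q [e [w [h [[uU0 uU1 hs0 hs1] gE [mq e0 hq] [lh dh]]]]]]]]]]
  := saturate (p := p.+1) (@transition_laurent _ _ E) dE gs s1n0.
have [P [Q [b [uP uQ PQ sb]]]] := birkhoff_grothendieck lh dh.
have [j hj] := avg_le b.
pose extend (M : 'M[{poly K}]_p.+1) : 'M_(1 + p.+1) := block_mx 1%:M 0 0 M.
have u_ext M : M \in unitmx -> extend M \in unitmx.
  by rewrite !unitmxE det_ublock det1 mul1r.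
have ext_col M (f : {poly K}) : extend M *m col_mx f%:M 0 = col_mx f%:M 0.
  by rewrite mul_block_col !mul0mx !mulmx0 mul1mx addr0 add0r.
(* The transition matrix in the frames where the quotient is split: the row of
   each summand of the quotient has a single nonzero entry, on the diagonal. *)
pose T : 'M[F]_(1 + p.+1) :=
  block_mx q%:M (w *m map_mx c1 (invmx Q)) 0 (xdiag K b).
have uA : extend P *m U0 \in unitmx by rewrite unitmx_mul u_ext.
have uB : extend Q *m U1 \in unitmx by rewrite unitmx_mul u_ext.
have TE : map_mx c0 (extend P *m U0) *m g = T *m map_mx c1 (extend Q *m U1).
  rewrite !map_mxM -mulmxA gE !mulmxA; congr (_ *m _).
  rewrite !map_block_mx !mulmx_block !map_mx1 !map_mx0 !mulmx0 !mul0mx !addr0 !add0r.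
  by rewrite !mul1mx !mulmx1 PQ -mulmxA -map_mxM mulVmx // map_mx1 mulmx1.
pose k : 'I_(1 + p.+1) := rshift 1 j.
pose f : 'I_p.+1 -> 'I_(1 + p.+1) := lift k.
have notf i : i \notin codom f -> i = k.
  by case: (unliftP k i) => [i' ->|//]; rewrite codom_f.
have Tk l : l != k -> T k l = 0.
  rewrite /T /k; case: (splitP l) => l' hl lk.
    by rewrite (_ : l = lshift _ l') ?block_mxEdl ?mxE //; apply: val_inj.
  have el : l = rshift 1 l' by apply: val_inj.
  rewrite el block_mxEdr xdiagE; case: eqP => // jl.
  by rewrite el jl eqxx in lk.
have Tkk : T k k = x ^ b j by rewrite /T /k block_mxEdr xdiagE eqxx.
have dT : monomial (d - b j) (\det (mxsub f f T)).
  have -> : \det (mxsub f f T) = \det T * (x ^ b j)^-1.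
    rewrite (expand_det_row T k) (bigD1 k) //= big1 ?addr0 => [|l /Tk ->]; last first.
      by rewrite mul0r.
    rewrite Tkk mulrAC divff ?xcoordXz_neq0 // mul1r /cofactor addnn -signr_odd.
    rewrite odd_double mul1r; congr (\det _).
    by apply/matrixP => i l; rewrite !mxE.
  apply: monomialM; last exact/monomialV/monomial_expz.
  rewrite det_ublock det_scalar1 det_xdiag sb.
  by have := monomialM mq (monomial_expz K (d - e)); rewrite addrC subrK.
have [|||i l /notf ->|||E' [dE' tE' subE']] :=
  @frame_subbundle _ _ E _ _ T f d (d - b j) _ _ (frame_inv uA uB TE).
- by rewrite unitmx_inv.
- by rewrite unitmx_inv.
- exact: lift_inj.
- by apply: Tk; rewrite eq_sym neq_lift.
- done.
- done.
pose v (g' : {poly K}) : 'cV[{poly K}]_(1 + p.+1) := col_mx g'%:M 0.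
have v0 g' i l : i \notin codom f -> v g' i l = 0.
  by move=> /notf ->; rewrite col_mxEd mxE.
exists (b j), E',
  (colsub f (invmx (extend P *m U0)), colsub f (invmx (extend Q *m U1))),
  (rowsub f (v g0), rowsub f (v g1)).
split; [exact: dE' | exact: subE' | by apply: le_trans hj _; rewrite sb; lia | |].
  rewrite /global_sections /= tE' !map_mxsub.
  have -> : mxsub f f T = rowsub f (colsub f T) by apply/matrixP => i l; rewrite !mxE.
  rewrite mul_rowsub_mx colsub_mul_rowsub; first 1 last.
  - exact: lift_inj.
  - by move=> i l /v0 vi; rewrite mxE vi rmorph0.
  congr (rowsub f _); rewrite !map_col_mx !map_mx0 !map_scalar_mx /= mul_block_col.
  by rewrite !mulmx0 mul0mx !addr0 -scalar_mxM hq.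
have cr (M : 'M_(1 + p.+1)) g' : colsub f M *m rowsub f (v g') = M *m v g'.
  exact: colsub_mul_rowsub (@lift_inj _ k) (v0 g').
rewrite /hom_sections /= !cr.
rewrite /v -(ext_col P g0) -(ext_col Q g1) -hs0 -hs1 ![extend _ *m (_ *m _)]mulmxA.
by rewrite !mulKmx //; case: (s).
Qed.

End Subbundles.

(** * Fibrewise injective maps and degree bounds *)

Section Subsystems.
Variable K : closedFieldType.
Local Notation F := (ratfun K).
Local Notation x := (xcoord K).
Local Notation c0 := (@chart0 K).
Local Notation c1 := (@chart1 K).
Local Notation eval u := (map_mx (fun p : {poly K} => p.[u])).

Lemma det_eval n (M : 'M[{poly K}]_n) u : \det (eval u M) = (\det M).[u].
Proof. by rewrite -[RHS]/(horner_eval u (\det M)) -det_map_mx. Qed.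

(** A minor that does not vanish at one point does not vanish as a polynomial, so
    injectivity on one fibre gives injectivity at the generic point. *)
Lemma row_full_generic k r (M : 'M[{poly K}]_(k, r)) (u : K) :
  \rank (eval u M) = r -> row_full (map_mx c0 M).
Proof.
move/eqP=> fM; have := fullrowsub_unit fM; set f := fullrankfun _ => uf.
have {uf} : rowsub f (map_mx c0 M) \in unitmx.
  rewrite unitmxE unitfE -map_mxsub det_map_mx chart0_eq0.
  move: uf; rewrite unitmxE unitfE -map_mxsub det_eval.
  by apply: contraNneq => ->; rewrite horner0.
move=> uf; apply/row_fullP; exists (invmx (rowsub f (map_mx c0 M)) *m rowsub f 1%:M).
by rewrite -mulmxA -rowsubE mulVmx.
Qed.

Lemma row_full_inj (L : fieldType) k r j (M : 'M[L]_(k, r)) (v w : 'M_(r, j)) :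
  row_full M -> M *m v = M *m w -> v = w.
Proof.
move=> /row_fullP[B BM] /(congr1 (mulmx B)).
by rewrite !mulmxA BM !mul1mx.
Qed.

Lemma row_full_cV (L : fieldType) k r (M : 'M[L]_(k, r)) :
  (forall v : 'cV_r, M *m v = 0 -> v = 0) -> row_full M.
Proof.
move=> h; suff : row_free M^T by rewrite /row_free mxrank_tr.
apply: inj_row_free => v /(congr1 trmx); rewrite trmx_mul trmxK trmx0 => /h vt.
by rewrite -[v]trmxK vt trmx0.
Qed.

(** A bundle of rank r and degree d that embeds generically into O(u)^k satisfies
    d <= u r: a nonzero minor of order r is a nonzero map from its determinant
    O(d) to O(u r). *)
Lemma degree_bound k r (M0 M1 : 'M[{poly K}]_(k, r)) (h : 'M[F]_r) u d :
  row_full (map_mx c0 M0) -> map_mx c0 M0 *m h = x ^ u *: map_mx c1 M1 ->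
  monomial d (\det h) -> d <= u * r%:Z.
Proof.
move=> fM hM dh; have := fullrowsub_unit fM; set f := fullrankfun _ => uf.
have := congr1 (fun N => \det (rowsub f N)) hM.
rewrite -mul_rowsub_mx det_mulmx -!map_mxsub.
have -> : rowsub f (x ^ u *: map_mx c1 M1) = x ^ u *: map_mx c1 (rowsub f M1).
  by apply/matrixP => i j; rewrite !mxE.
rewrite detZ !det_map_mx mulrC => e.
apply: (monomial_le dh _ _ e); last first.
  by rewrite -chart0_eq0 -det_map_mx map_mxsub -unitfE -unitmxE.
by rewrite exprnP exprz_exp; apply: monomial_expz.
Qed.

(** The determinant has no root in K, which is algebraically closed. *)
Lemma unitmx_fibrewise n (M : 'M[{poly K}]_n) :
  (forall u, \rank (eval u M) = n) -> M \in unitmx.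
Proof.
move=> h; rewrite unitmxE.
have dn0 u : (\det M).[u] != 0.
  by rewrite -det_eval -unitfE -unitmxE -row_full_unit /row_full h.
have : size (\det M) == 1%N.
  apply: contraT => /closed_rootP[u]; rewrite rootE => /eqP ru.
  by have := dn0 u; rewrite ru eqxx.
move/eqP => s1; have /size_poly1P[c cn0 ->] : size (\det M) == 1%N by rewrite s1.
exact: const_unit.
Qed.

Lemma subbundle_full n n' (E : vector_bundle K n) (E' : vector_bundle K n') A :
  is_subbundle E' E A -> row_full (map_mx c0 A.1) /\ row_full (map_mx c0 A.2).
Proof.
by move=> [_ /(_ 0)[/row_full_generic ? /row_full_generic ?]].
Qed.

Lemma map_chart0_inj k r : injective (@map_mx _ _ c0 k r).
Proof.
move=> M N h; apply/matrixP => i j; apply: chart0_inj.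
by have /matrixP/(_ i j) := h; rewrite !mxE.
Qed.

Lemma hom_sections_inj n n' (E : vector_bundle K n) (E' : vector_bundle K n') A s :
  is_subbundle E' E A -> hom_sections A s = 0 -> s = 0.
Proof.
move=> /subbundle_full[f0 f1]; rewrite /hom_sections; case: s => s0 s1 /= [h0 h1].
congr (_, _); apply: map_chart0_inj.
  by apply: (row_full_inj f0); rewrite -map_mxM h0 !map_mx0 mulmx0.
by apply: (row_full_inj f1); rewrite -map_mxM h1 !map_mx0 mulmx0.
Qed.

Lemma subbundle_rank n n' (E : vector_bundle K n) (E' : vector_bundle K n') A :
  is_subbundle E' E A -> (n' <= n)%N.
Proof. by move=> [_ /(_ 0)[r0 _]]; have := rank_leq_row (eval 0 A.1); rewrite r0. Qed.

Lemma subbundle_iso n (E E' : vector_bundle K n) A :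
  is_subbundle E' E A -> is_iso E' E A.
Proof.
move=> [hA rA]; have u0 : A.1 \in unitmx by apply: unitmx_fibrewise => u; case: (rA u).
have u1 : A.2 \in unitmx by apply: unitmx_fibrewise => u; case: (rA u).
split=> //; exists (invmx A.1, invmx A.2).
by split; rewrite /= ?mulmxV ?mulVmx //; apply: frame_inv.
Qed.

Lemma hom_sectionsZ n n' (A : hom_data K n' n) c s :
  hom_sections A (c *: s) = c *: hom_sections A s.
Proof. by rewrite /hom_sections /= -!scalemxAr. Qed.

Lemma hom_sectionsD n n' (A : hom_data K n' n) s s' :
  hom_sections A (s + s') = hom_sections A s + hom_sections A s'.
Proof. by rewrite /hom_sections /= !mulmxDr. Qed.

Lemma hom_sections0 n n' (A : hom_data K n' n) : hom_sections A 0 = 0.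
Proof. by rewrite /hom_sections /= !mulmx0. Qed.

(** A subbundle map is injective on sections, so the space of sections of a
    subsystem embeds into the line spanned by s. *)
Lemma subsystem_line n d n' d' k' (s : section_data K n)
    (S : coherent_system K n d 1) (S' : coherent_system K n' d' k') A :
  sections S = [set t | exists c : K, t = c%:P *: s] ->
  is_subsystem S' S A ->
  k' = 0%N \/ k' = 1%N /\ exists s', [/\ sections S' s', global_sections (bundle S') s' &
    hom_sections A s' = s].
Proof.
move=> VS [n'0 subA AV].
have [b [free_b Vb]] := sections_dim S'.
have Sb i : sections S' (b i).
  rewrite Vb; exists (fun j => (i == j)%:R); rewrite (bigD1 i) //= eqxx scale1r.
  by rewrite big1 ?addr0 // => j ji; rewrite eq_sym (negPf ji) scale0r.
have /fin_all_exists[g hg] : forall i, exists c : K, hom_sections A (b i) = c%:P *: s.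
  move=> i; have : sections S (hom_sections A (b i)) by apply: AV; exists (b i).
  by rewrite VS.
have homsum (v : 'I_k' -> K) : hom_sections A (\sum_i (v i)%:P *: b i) =
    (\sum_i v i * g i)%:P *: s.
  rewrite (big_morph _ (hom_sectionsD A) (hom_sections0 A)).
  rewrite rmorph_sum scaler_suml; apply: eq_bigr => i _ /=.
  by rewrite hom_sectionsZ hg scalerA polyCM.
(* The coordinates g i of the images of a basis of the sections of S' along s form a column
   with independent rows, and such a column has at most one row. *)
have : row_free (\col_i g i).
  apply: inj_row_free => v vg; apply/rowP => i; rewrite mxE.
  apply: (free_b (fun i => v 0 i)); apply: (hom_sections_inj subA).
  rewrite homsum; have /matrixP/(_ 0 0) := vg; rewrite !mxE.
  by under eq_bigr do rewrite mxE; move=> ->; rewrite scale0r.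
move=> rf; have : (k' <= 1)%N by rewrite -(eqP rf) rank_leq_col.
case: k' => [|[|//]] in S' subA AV b free_b Vb g Sb hg homsum rf *; first by left.
right; split=> //; have gn0 : g ord0 != 0.
  apply: contraTneq rf => g0; rewrite (_ : \col_i g i = 0) /row_free ?mxrank0 //.
  by apply/matrixP => i j; rewrite !mxE ord1.
have Ss : sections S' ((g ord0)^-1%:P *: b ord0).
  rewrite -[_ *: _]addr0; apply: (proj2 (sections_subspace S')) => //.
  exact: (proj1 (sections_subspace S')).
exists ((g ord0)^-1%:P *: b ord0); split; [exact: Ss | exact: sections_global Ss |].
by rewrite hom_sectionsZ hg scalerA -polyCM mulVf // scale1r.
Qed.

End Subsystems.

(** * A balanced bundle with a monomial section *)

Section ExtremalSystem.
Variable K : closedFieldType.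
Local Notation F := (ratfun K).
Local Notation x := (xcoord K).
Local Notation c0 := (@chart0 K).
Local Notation c1 := (@chart1 K).
Variables p t l m : nat.

(** The number a of the theorem, in terms of the rank n = p.+1 and of t, l and m. *)
Definition top_degree : nat := (l * p + m + t)%N.

(** The floor f of d/(n-1) when m < n - 1. *)
Definition quot_degree : nat := (l * p.+1 + m + t)%N.

(** Degrees of the summands of O(a-1)^t + O(a)^(n-t). *)
Definition summand_degree (i : 'I_p.+1) : nat := (top_degree - (i < t))%N.

(** Partial sums of the differences f - a_j, which are l + 1 for j < t and l
    afterwards. *)
Definition section_exponent (i : nat) : nat := (i * l + minn i t)%N.
Local Notation a := top_degree.
Local Notation f := quot_degree.
Local Notation ai := summand_degree.
Local Notation ci := section_exponent.

Lemma exponent_le_degree (i : 'I_p.+1) : (ci i <= ai i)%N.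
Proof.
rewrite /ci /ai /a; have := ltn_ord i; rewrite ltnS => ip.
have : (i * l <= p * l)%N by rewrite leq_mul2r ip orbT.
case: (ltnP i t) => it /=; nia.
Qed.

(** The entry x^(c_i - c_j) in row i = j + 1 is exactly of the degree allowed for a
    map from the j-th summand to O(f). *)
Lemma exponent_step (i j : 'I_p.+1) : i = j.+1 :> nat -> (ci i - ci j + ai j = f)%N.
Proof.
move=> ij; have := ltn_ord i; rewrite ij ltnS => jp.
rewrite /ci /ai /a /f.
case: (ltnP j t) => jt /=; nia.
Qed.

Lemma summand_degree_le (i : 'I_p.+1) : (ai i <= a)%N.
Proof. by rewrite /ai leq_subr. Qed.

Lemma summand_degree_le_quot (i : 'I_p.+1) : (ai i <= f)%N.
Proof. rewrite /ai /a /f; nia. Qed.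

Lemma sum_summand_degree : (t <= p)%N ->
  \sum_(i < p.+1) (ai i)%:Z = p.+1%:Z * a%:Z - t%:Z.
Proof.
move=> le_tp.
have -> : \sum_(i < p.+1) (ai i)%:Z = \sum_(i < p.+1) (a%:Z - (i < t)%N%:Z).
  apply: eq_bigr => i _; rewrite /ai /a; case: (ltnP i t) => it; lia.
rewrite sumrB sumr_const card_ord -mulr_natl natz; congr (_ - _).
rewrite -(big_mkord xpredT (fun i => (i < t)%N%:Z)) (big_cat_nat _ (n := t)) //=;
  last lia.
rewrite [X in _ + X]big_nat [X in _ + X]big1 => [|i /andP[ti _]];
  last by rewrite ltnNge ti.
rewrite big_nat (eq_bigr (fun=> 1)) => [|i /andP[_ ->//]].
by rewrite -big_nat sumr_const_nat subn0 addr0 natz.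
Qed.

(** The section with components x^(c_i) of O(a_i), read in y as y^(a_i - c_i).
    Its first component is 1 in the coordinate x, and its last one is y^m at
    infinity: these two entries determine its zeros. *)
Definition monomial_section : section_data K p.+1 :=
  (\col_i 'X^(ci i), \col_i 'X^(ai i - ci i)).
Local Notation s := monomial_section.

(** In the coordinate x, the map from E to O(f)^n with components
    x^(c_i - c_(i-1)) e_(i-1)^* - e_i^* for 0 < i.  The row 0 is zero, which
    keeps the matrix square and the indices aligned. *)
Definition quot0 : 'M[{poly K}]_p.+1 := \matrix_(i, j)
  if (i == j.+1 :> nat) then 'X^(ci i - ci j) else - (((i == j) && (0 < i)%N)%:R).

(** The same map in the coordinate y. *)
Definition quot1 : 'M[{poly K}]_p.+1 := \matrix_(i, j)
  if (i == j.+1 :> nat) then 1 else - ('X^(f - ai j) *+ ((i == j) && (0 < i)%N)).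

Local Notation D := (xdiag K (fun i => (ai i)%:Z)).

Lemma quot_hom : map_mx c0 quot0 *m D = x ^ f%:Z *: map_mx c1 quot1.
Proof.
apply/matrixP => i j; rewrite mul_mx_diag !mxE.
case: eqP => [ij|_].
  by rewrite rmorph1 mulr1 chart0Xn !exprnP -xcoordXzD -PoszD exponent_step.
case: eqP => [->|_] /=; last by rewrite !rmorphN !rmorph0 !oppr0 mul0r mulr0.
case: (0 < j)%N; last by rewrite !rmorphN !rmorph0 !oppr0 mul0r mulr0.
rewrite !rmorphN rmorph1 /= chart1Xn mulrN mulN1r; congr (- _).
have {1}-> : f%:Z = (ai j)%:Z + (f - ai j)%N%:Z.
  by have := summand_degree_le_quot j; lia.
by rewrite xcoordXzD -mulrA -exprnP mulfV ?mulr1 // xcoordX_neq0.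
Qed.

Lemma quot_row (v : 'cV[F]_p.+1) (i : 'I_p.+1) : map_mx c0 quot0 *m v = 0 ->
  forall j : 'I_p.+1, i = j.+1 :> nat -> v i 0 = x ^+ (ci i - ci j) * v j 0.
Proof.
move=> /matrixP/(_ i 0) + j ij; rewrite !mxE (bigD1 j) //= (bigD1 i) /=; last first.
  by rewrite -(inj_eq val_inj) /= ij; lia.
rewrite big1 ?addr0 => [|k /andP[kj ki]].
  rewrite !mxE ij eqxx -ij eqxx /= (_ : (i == i.+1 :> nat) = false); last by lia.
  rewrite [in (0 < i)%N]ij /= rmorphN rmorph1 mulN1r chart0Xn.
  by move=> /eqP; rewrite subr_eq0 => /eqP.
rewrite !mxE (_ : (i == k.+1 :> nat) = false); last first.
  apply/negbTE; apply: contraNneq kj => ik; apply/eqP/val_inj/eqP.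
  by rewrite -eqSS /= -ij ik.
by rewrite [i == k]eq_sym (negPf ki) /= rmorphN rmorph0 oppr0 mul0r.
Qed.

(** A vector in the kernel is determined by its entry 0, the recursion of [quot_row]
    being that of the exponents. *)
Lemma quot_kernel (v : 'cV[F]_p.+1) : map_mx c0 quot0 *m v = 0 ->
  v = v 0 0 *: map_mx c0 s.1.
Proof.
move=> hv; apply/matrixP => i j; rewrite ord1 !mxE chart0Xn {j}.
case: i => i; elim: i => [|i IH] hi.
  by rewrite /ci mul0n min0n expr0 mulr1; congr (v _ _); apply: val_inj.
rewrite (quot_row (i := Ordinal hi) hv (j := Ordinal (ltnW hi))) // IH mulrCA -exprD /=.
by congr (_ * _ ^+ _); rewrite subnK // /ci; nia.
Qed.

Lemma quot_section : quot0 *m s.1 = 0.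
Proof.
apply: (@map_chart0_inj K); rewrite map_mxM map_mx0; apply/matrixP => i j.
rewrite ord1 mxE [RHS]mxE.
have [i0|i0] := posnP i.
  by apply: big1 => k _; rewrite !mxE i0 /= andbF rmorphN rmorph0 oppr0 mul0r.
have ip : (i.-1 < p.+1)%N by have := ltn_ord i; lia.
pose j' := Ordinal ip; have ij : i = j'.+1 :> nat by rewrite /= prednK.
rewrite (bigD1 j') //= (bigD1 i) /=; last first.
  by rewrite -(inj_eq val_inj) /=; lia.
rewrite big1 ?addr0 => [|k /andP[kj ki]].
  rewrite !mxE -ij eqxx (_ : (i == i.+1 :> nat) = false); last by lia.
  rewrite eqxx i0 /= rmorphN rmorph1 mulN1r !chart0Xn -exprD subnK ?subrr //.
  by rewrite /ci; nia.
rewrite !mxE (_ : (i == k.+1 :> nat) = false); last first.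
  by apply/negbTE; apply: contraNneq kj => ik; apply/eqP/val_inj => /=; rewrite ik.
by rewrite [i == k]eq_sym (negPf ki) /= rmorphN rmorph0 oppr0 mul0r.
Qed.

Lemma monomial_section_global (E : vector_bundle K p.+1) :
  transition E = D -> global_sections E s.
Proof.
move=> tE; rewrite /global_sections /= tE mul_diag_mx; apply/matrixP => i j.
rewrite !mxE chart0Xn chart1Xn.
have {1}-> : (ai i)%:Z = (ci i)%:Z + (ai i - ci i)%N%:Z.
  by rewrite -PoszD subnKC // exponent_le_degree.
by rewrite xcoordXzD -mulrA -!exprnP mulfV ?mulr1 // xcoordX_neq0.
Qed.

Lemma monomial_section_neq0 : s != 0.
Proof.
apply/eqP => -[/matrixP/(_ 0 0)]; rewrite !mxE => /eqP.
by rewrite expf_eq0 polyX_eq0 andbF.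
Qed.

(** The summands have degree at most a, so E embeds into O(a)^n. *)
Lemma subbundle_degree_le (E : vector_bundle K p.+1) n' d' (E' : vector_bundle K n') A :
  transition E = D -> is_subbundle E' E A -> has_degree E' d' -> d' <= a%:Z * n'%:Z.
Proof.
move=> tE subA dE'; have [f0 _] := subbundle_full subA.
pose M1 : 'M[{poly K}]_(p.+1, n') := \matrix_(i, j) ('X^(a - ai i) * A.2 i j).
apply: (degree_bound (M1 := M1) f0 _ dE').
rewrite (proj1 subA) tE mul_diag_mx; apply/matrixP => i j; rewrite !mxE rmorphM /=.
rewrite chart1Xn mulrA; congr (_ * _).
have {1}-> : a%:Z = (ai i)%:Z + (a - ai i)%N%:Z.
  by have := summand_degree_le i; lia.
by rewrite xcoordXzD -mulrA -exprnP mulfV ?mulr1 // xcoordX_neq0.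
Qed.

(** Saturate s' in E' to O(e).  The quotient of E' by O(e) embeds generically into
    O(f)^n, because the kernel of [quot0] is spanned by the section; this gives
    d' - e <= f r.  Moreover e <= m, since s vanishes to order m at infinity and
    nowhere else. *)
Lemma subbundle_section_degree_le (E : vector_bundle K p.+1) r d'
    (E' : vector_bundle K r.+1) A s' :
  (t <= p)%N -> transition E = D -> is_subbundle E' E A -> has_degree E' d' ->
  global_sections E' s' -> hom_sections A s' = s ->
  d' <= f%:Z * r%:Z + m%:Z.
Proof.
move=> le_tp tE subA dE' gs' As'; have [f0 _] := subbundle_full subA.
have As0 : A.1 *m s'.1 = s.1 by rewrite -As'.
have As1 : A.2 *m s'.2 = s.2 by rewrite -As'.
have s'0 : s'.1 != 0.
  apply: contraNneq (oner_neq0 {poly K}) => s'0.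
  by have /matrixP/(_ 0 0) := As0; rewrite s'0 mulmx0 !mxE /ci mul0n min0n expr0 => <-.
have [U0 [U1 [g0 [g1 [q [e [w [h [[uU0 uU1 hs0 hs1] gE [mq e0 hq] [lh dh]]]]]]]]]]
  := saturate (p := r) (@transition_laurent _ _ E') dE' gs' s'0.
pose B0 : 'M_(p.+1, 1 + r) := A.1 *m invmx U0.
pose B1 : 'M_(p.+1, 1 + r) := A.2 *m invmx U1.
have B0s : B0 *m col_mx g0%:M 0 = s.1 by rewrite -hs0 /B0 -mulmxA mulKmx.
have B1s : B1 *m col_mx g1%:M 0 = s.2 by rewrite -hs1 /B1 -mulmxA mulKmx.
have colE (M : 'M[{poly K}]_(p.+1, 1 + r)) g i :
    (M *m col_mx g%:M 0) i 0 = M i (lshift r 0) * g.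
  by rewrite -[M in LHS]hsubmxK mul_row_col mulmx0 addr0 mul_mx_scalar !mxE mulrC.
have e1 : B0 0 (lshift r 0) * g0 = 1.
  by rewrite -colE B0s mxE /ci mul0n min0n expr0.
have g0n0 : g0 != 0.
  by apply: contra_eq_neq e1 => ->; rewrite mulr0 eq_sym oner_neq0.
have le_em : e <= m%:Z.
  have AC (L : comNzRingType) (k y b u : L) : k * y * b * u = b * (k * u) * y by ring.
  (* The generator g1 of the section at infinity divides the last component y^m. *)
  have e2 : B1 ord_max (lshift r 0) * g1 = 'X^m.
    rewrite -colE B1s mxE; congr ('X^_); rewrite /ci /ai /a /=.
    by rewrite ltnNge le_tp (minn_idPr le_tp) subn0 mulnC addnAC addKn.
  have B00 : B0 0 (lshift r 0) != 0.
    by apply: contra_eq_neq e1 => ->; rewrite mul0r eq_sym oner_neq0.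
  have mqm : monomial (e - m%:Z) (q * x ^ (- m%:Z)).
    exact: monomialM mq (monomial_expz _ _).
  have : e - m%:Z <= 0; last lia.
  apply: (monomial_le mqm (monomial_expz K 0) B00 (p' := B1 ord_max (lshift r 0))).
  rewrite expr0z mul1r; apply: (@mulIf _ (c1 g1)).
    rewrite chart1_eq0; apply: contra_eq_neq e2 => ->.
    by rewrite mulr0 eq_sym expf_eq0 polyX_eq0 andbF.
  have e3 : c0 (B0 0 (lshift r 0)) * (q * c1 g1) = 1.
    by rewrite -hq -rmorphM e1 rmorph1.
  have e4 : c1 (B1 ord_max (lshift r 0)) * c1 g1 = x ^ (- m%:Z).
    by rewrite -rmorphM e2 /= chart1Xn -invr_expz -exprnP.
  by rewrite e4 -[RHS]mul1r -e3 AC.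
(* The composite E' -> E -> O(f)^n in the saturated frames; it kills the first
   basis vector, so only its last r columns matter. *)
pose N0 := quot0 *m B0; pose N1 := quot1 *m B1.
have N0l : lsubmx N0 = 0.
  apply/matrixP => i j; rewrite ord1 [RHS]mxE mxE; apply: (mulIf g0n0).
  by rewrite mul0r -colE -mulmxA B0s quot_section mxE.
have N0h : map_mx c0 (rsubmx N0) *m h = x ^ f%:Z *: map_mx c1 (rsubmx N1).
  have : map_mx c0 N0 *m block_mx q%:M w 0 h = x ^ f%:Z *: map_mx c1 N1.
    rewrite !map_mxM -!mulmxA (frame_inv uU0 uU1 gE) (mulmxA (map_mx c0 A.1)).
    rewrite (proj1 subA) tE -!mulmxA (mulmxA (map_mx c0 quot0)) quot_hom.
    by rewrite -scalemxAl.
  rewrite -[N0]hsubmxK -[N1]hsubmxK N0l !map_row_mx mul_row_block scale_row_mx.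
  by rewrite map_mx0 !mul0mx !add0r !row_mxKr => /eq_row_mx[].
have full : row_full (map_mx c0 (rsubmx N0)).
  have [B BA] := row_fullP f0.
  have fullB : row_full (map_mx c0 B0).
    apply/row_fullP; exists (map_mx c0 U0 *m B).
    rewrite map_mxM -mulmxA (mulmxA B) BA mul1mx -map_mxM mulmxV //.
    by rewrite map_mx1.
  apply: row_full_cV => v hv.
  have /quot_kernel : map_mx c0 quot0 *m (map_mx c0 B0 *m col_mx 0 v) = 0.
    rewrite mulmxA -map_mxM -/N0 -[N0]hsubmxK N0l map_row_mx mul_row_col hv.
    by rewrite mulmx0 addr0.
  rewrite -B0s (map_mxM _ B0) scalemxAr => /(row_full_inj fullB).
  by rewrite map_col_mx map_mx0 scale_col_mx scaler0 => /eq_col_mx[].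
have := degree_bound full N0h dh; lia.
Qed.

End ExtremalSystem.

(** * Stability *)

Lemma slope_ltE (R : realType) (alpha : R) n' d' k' n d k :
  (0 < n')%N -> (0 < n)%N ->
  (slope alpha n' d' k' < slope alpha n d k) =
  ((d'%:~R + alpha * k'%:R) * n%:R < (d%:~R + alpha * k%:R) * n'%:R).
Proof.
move=> n'0 n0; have sE i e j : slope alpha i e j = (e%:~R + alpha * j%:R) / i%:R.
  by rewrite /slope mulrA mulrDl.
by rewrite !sE ltr_pdivrMr ?ltr0n // mulrAC ltr_pdivlMr ?ltr0n.
Qed.

(** Without a section, the inequality follows from d' <= a n' and t < alpha.  With
    the section and rank r + 1 < n, it follows from d' <= f r + m: the difference
    of the two sides, with denominators cleared, is then at least
    (p - r) (f - m - alpha), and f - m = n l + t.  A subsystem with the section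
    and of full rank is the whole system. *)
Lemma balanced_stable (K : closedFieldType) (R : realType) (alpha : R) (p t l m : nat) :
  (t <= p)%N -> t%:R < alpha < (p.+1 * l + t)%:R ->
  exists S : coherent_system K p.+1 (p.+1%:Z * (top_degree p t l m)%:Z - t%:Z) 1,
    stable alpha S.
Proof.
move=> le_tp /andP[t_alpha alpha_lt]; set a := top_degree p t l m.
set d : int := _ - _; set s := monomial_section K p t l m.
pose D := xdiag K (fun i => (@summand_degree p t l m i)%:Z).
have dD : monomial d (\det D).
  rewrite det_xdiag (sum_summand_degree l m le_tp); exact: monomial_expz.
have [E tE dE] := bundle_of_det (@laurent_xdiag K _ _) dD.
have globs : [set u | exists b : K, u = b%:P *: s] `<=` global_sections E.
  move=> u [b ->]; apply: global_sectionsZ; exact: monomial_section_global.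
have s0 : s != 0 := monomial_section_neq0 K p t l m.
pose S := CoherentSystem dE globs (subspace_line s) (has_dim1I s0).
exists S => n' d' k' S' A subS notiso.
have [n'0 subA AV] := subS.
have n'n : (n' <= p.+1)%N := subbundle_rank subA.
rewrite slope_ltE //.
have n'R : 0 < n'%:R :> R by rewrite ltr0n.
have [k'0|[k'1 [s' [Ss' gs' As']]]] := subsystem_line (S := S) erefl subS.
  have := subbundle_degree_le tE subA (bundle_degree S'); rewrite -/a => le_d'.
  have : d'%:~R <= a%:R * n'%:R :> R.
    by rewrite -natrM pmulrn ler_int PoszM.
  have dR : d%:~R = p.+1%:R * a%:R - t%:R :> R by rewrite /d rmorphB rmorphM.
  rewrite k'0 dR mulr0 addr0 mulr1 => le_d'R.
  have p0 : 0 < p.+1%:R :> R by rewrite ltr0n.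
  have h1 : 0 < (alpha - t%:R) * n'%:R by rewrite mulr_gt0 // subr_gt0.
  have h2 : 0 <= (a%:R * n'%:R - d'%:~R) * p.+1%:R :> R.
    by apply: mulr_ge0; rewrite ?subr_ge0 // ltW.
  lra.
case: n' => // r in S' A subS notiso subA AV n'0 n'n n'R s' Ss' gs' As' *.
have [rp|] := ltnP r p; last first.
  move=> pr; have {n'n} rp : r = p by apply/eqP; rewrite eqn_leq pr -ltnS n'n.
  subst r; case: notiso; split; first exact: subbundle_iso.
  apply/seteqP; split=> // u [b ->]; exists (b%:P *: s');
    last by rewrite hom_sectionsZ As'.
  rewrite -[_ *: _]addr0; apply: (proj2 (sections_subspace S')) => //.
  exact: (proj1 (sections_subspace S')).
have := subbundle_section_degree_le le_tp tE subA (bundle_degree S') gs' As'.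
set f := quot_degree p t l m => le_d'.
have le_d'R : d'%:~R <= f%:R * r%:R + m%:R :> R.
  by rewrite -natrM -natrD pmulrn ler_int PoszD PoszM.
have dR : d%:~R = p%:R * f%:R + m%:R :> R.
  rewrite -natrM -natrD pmulrn; congr (_%:~R).
  by rewrite /d /f /a /top_degree /quot_degree; lia.
have fR : f%:R = (p.+1 * l + t)%:R + m%:R :> R.
  by rewrite -natrD /f /quot_degree; congr (_%:R); lia.
clearbody f; rewrite k'1 dR mulr1 -[p.+1]addn1 -[r.+1]addn1 !natrD.
have h1 : 0 < (p%:R - r%:R) * (f%:R - m%:R - alpha).
  by rewrite mulr_gt0 // ?subr_gt0 ?ltr_nat // fR addrK.
have h2 : 0 <= (f%:R * r%:R + m%:R - d'%:~R) * (p%:R + 1%:R) :> R.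
  by apply: mulr_ge0; rewrite ?subr_ge0 // addr_ge0.
lra.
Qed.

(** The inequalities that stability imposes on the two subsystems of
    [line_subbundle] and [corank1_subbundle]. *)
Lemma stable_degree_bounds (K : closedFieldType) (R : realType) (alpha : R) p d
    (S : coherent_system K p.+2 d 1) : stable alpha S ->
  (exists2 e : int, d <= p.+2%:Z * e & (p.+2%:Z * e - d)%:~R < alpha) /\
  (exists2 b : int, p.+1%:Z * b <= d & alpha < (p.+2%:Z * b - d)%:~R).
Proof.
move=> stS; have dE := bundle_degree S; split.
  have [e [L [A [dL sL de]]]] := line_subbundle dE; exists e => //.
  have := stable_slope0 stS (ltn0Sn 0) sL dL; rewrite slope_ltE //.
  by rewrite mulr0 addr0 !mulr1 rmorphB rmorphM /= mulrC ltrBlDl.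
have [s sn0 VS] := has_dim1 (sections_dim S).
have Ss : sections S s by rewrite VS; exists 1; rewrite scale1r.
have [b [E' [A [s' [dE' sE' bd gs' As']]]]] :=
  corank1_subbundle dE (sections_global Ss) sn0.
exists b => //.
have lt_p : (0 < p.+1 < p.+2)%N by rewrite ltnSn.
have := stable_slope1 stS lt_p sE' dE' gs'; rewrite As' => /(_ sn0 Ss).
rewrite slope_ltE // !rmorphB rmorphM /= !mulr1 -[p.+2]addn1 natrD.
lra.
Qed.

Theorem theorem5p1 (K : closedFieldType) (R : realType)
  (n : nat) (hn : (2 <= n)%N) (d : int) (alpha : R) (a t l m : int)
  (hd : d = n%:Z * a - t) (ht : 0 <= t < n%:Z)
  (hl : a - t = l * (n%:Z - 1) + m) (hm : 0 <= m < n%:Z - 1) :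
  @moduli K R alpha n d 1 !=set0 <->
  t%:~R < alpha < d%:~R / (n%:R - 1) - m%:~R * n%:R / (n%:R - 1).
Proof.
case: n => [|[|p]] // in hn hd ht hl hm *.
have p1 : p.+2%:R - 1 = p.+1%:R :> R by rewrite -[p.+2]addn1 natrD addrK.
have ubound : d%:~R / (p.+2%:R - 1) - m%:~R * p.+2%:R / (p.+2%:R - 1)
    = (p.+2%:Z * l + t)%:~R :> R.
  have -> : d = p.+1%:Z * (p.+2%:Z * l + t) + m * p.+2%:Z by nia.
  rewrite p1 -mulrBl rmorphD rmorphM (rmorphM _ m) /= addrK mulrAC mulfV ?mul1r //.
  by rewrite pnatr_eq0.
rewrite ubound; split.
  move=> [_ [S stS _]].
  have [[e de he] [b bd hb]] := stable_degree_bounds stS.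
  apply/andP; split.
    apply: le_lt_trans he; rewrite ler_int.
    have : a <= e by nia.
    nia.
  apply: lt_le_trans hb _; rewrite ler_int.
  have : b <= p.+2%:Z * l + t + m by nia.
  nia.
move=> /andP[t_alpha alpha_lt].
(* The interval for alpha is nonempty, which forces l > 0, and a, l, t, m are then
   natural numbers. *)
have l0 : 0 < l.
  have : t < p.+2%:Z * l + t by rewrite -(ltr_int R) (lt_trans t_alpha).
  by rewrite ltrDr pmulr_rgt0.
case: l l0 => // l l0 in hl ubound alpha_lt *.
case: t => // t in hd ht hl t_alpha alpha_lt ubound *.
case: m => // m in hm hl ubound *.
have aE : a = (top_degree p.+1 t l m)%:Z by rewrite /top_degree; nia.
rewrite {}aE in hd; rewrite {}hd.
have le_tp : (t <= p.+1)%N by lia.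
have [|S stS] := @balanced_stable K R alpha p.+1 t l m le_tp.
  by rewrite t_alpha.
by exists [set T | isomorphic T S], S.
Qed.
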